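(* Let the $q$-hypergeometric Euler numbers of the second kind $\widehat{\mathcal E}_{N,k}$ be defined by $\sum_{k=0}^\infty\widehat{\mathcal E}_{N,k}\frac{x^k}{k!}=\left(\sum_{n=0}^\infty\frac{[2N+1]_q!\,x^{2n}}{[2N+2n+1]_q!}\right)^{-1}$. For all integers $N\ge 0$ and $n\ge 1$, $$\widehat{\mathcal E}_{N,2n}=(-1)^n(2n)!\begin{vmatrix} \frac{[2N+1]_q!}{[2N+3]_q!}&1&0&&\\ \frac{[2N+1]_q!}{[2N+5]_q!}&\frac{[2N+1]_q!}{[2N+3]_q!}&1&&\\ \vdots&\vdots&\ddots&1&0\\ \frac{[2N+1]_q!}{[2N+2n-1]_q!}&\frac{[2N+1]_q!}{[2N+2n-3]_q!}&\cdots&\frac{[2N+1]_q!}{[2N+3]_q!}&1\\ \frac{[2N+1]_q!}{[2N+2n+1]_q!}&\frac{[2N+1]_q!}{[2N+2n-1]_q!}&\cdots&\frac{[2N+1]_q!}{[2N+5]_q!}&\frac{[2N+1]_q!}{[2N+3]_q!} \end{vmatrix},$$ where the $n\times n$ matrix has $(i,j)$ entry $\frac{[2N+1]_q!}{[2N+1+2(i-j+1)]_q!}$ if $i\ge j$, $1$ if $j=i+1$, and $0$ if $j>i+1$.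
   Context: $q\ne 1$ is a complex number that is not a root of unity; $[n]_q=\frac{1-q^n}{1-q}$, $[n]_q!=[n]_q[n-1]_q\cdots[1]_q$ for $n\ge1$, and $[0]_q!=1$. Generating functions are formal power series in $x$. *)

(* Defs.v *)
From HB Require Import structures.
From mathcomp Require Import all_boot all_order all_algebra.
From mathcomp Require Import reals complex.
Set Implicit Arguments.
Unset Strict Implicit.
Unset Printing Implicit Defensive.
Import Order.TTheory GRing.Theory Num.Theory.
Local Open Scope ring_scope.

(* A formal power series is the sequence of its coefficients. *)
Definition fps (K : Type) := nat -> K.

Section FormalPowerSeries.
Variable K : fieldType.
Implicit Types f g : fps K.

Definition fps_one : fps K := fun k => (k == 0%N)%:R.

Definition fps_mul f g : fps K := fun k => \sum_(i < k.+1) f i * g (k - i)%N.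

(* The first n coefficients of 1/f, obtained by solving g * f = 1 coefficient
   by coefficient; only meaningful when f 0 != 0. *)
Fixpoint fps_inv_seq f (n : nat) : seq K :=
  if n is m.+1 then
    let s := fps_inv_seq f m in
    rcons s (((m == 0%N)%:R - \sum_(i < m) s`_i * f (m - i)%N) / f 0%N)
  else [::].

Definition fps_inv f : fps K := fun k => (fps_inv_seq f k.+1)`_k.

Lemma size_fps_inv_seq f n : size (fps_inv_seq f n) = n.
Proof. by elim: n => //= n IHn; rewrite size_rcons IHn. Qed.

Lemma nth_fps_inv_seq f n i : (i < n)%N -> (fps_inv_seq f n)`_i = fps_inv f i.
Proof.
elim: n => // n IHn; rewrite ltnS leq_eqVlt => /orP[/eqP-> // | lt_in].
by rewrite /= nth_rcons size_fps_inv_seq lt_in IHn.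
Qed.

Lemma fps_invE f k :
  fps_inv f k =
    ((k == 0%N)%:R - \sum_(i < k) fps_inv f i * f (k - i)%N) / f 0%N.
Proof.
rewrite {1}/fps_inv /= nth_rcons size_fps_inv_seq ltnn eqxx.
by under eq_bigr => i _ do rewrite nth_fps_inv_seq //.
Qed.

Lemma fps_mulVf f : f 0%N != 0 -> fps_mul (fps_inv f) f =1 fps_one.
Proof.
move=> f0 k; rewrite /fps_mul big_ord_recr /= subnn [in X in _ + X]fps_invE.
by rewrite divfK // addrC subrK.
Qed.

Lemma fps_inv_unique f g :
  f 0%N != 0 -> fps_mul g f =1 fps_one -> g =1 fps_inv f.
Proof.
move=> f0 gf1; elim/ltn_ind => k IHk.
have := gf1 k; rewrite /fps_mul big_ord_recr /= subnn /fps_one => gfk.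
rewrite fps_invE; under [X in _ - X]eq_bigr => i _ do rewrite -IHk //.
by rewrite -gfk [X in X - _]addrC addrK mulfK.
Qed.

End FormalPowerSeries.

Section QEuler.
Variable K : numFieldType.
Variable q : K.

Definition qint (n : nat) : K := (1 - q ^+ n) / (1 - q).

Definition qfact (n : nat) : K := \prod_(1 <= i < n.+1) qint i.

Definition qEuler2_ratio (N n : nat) : K :=
  qfact (2 * N + 1)%N / qfact (2 * N + 2 * n + 1)%N.

(* The series \sum_n qEuler2_ratio N n x^(2n): odd coefficients vanish. *)
Definition qEuler2_series (N : nat) : fps K :=
  fun k => if odd k then 0 else qEuler2_ratio N k./2.

(* Coefficients of the exponential generating function
   \sum_k qEuler2 N k x^k / k! = 1 / qEuler2_series N. *)
Definition qEuler2 (N k : nat) : K := k`!%:R * fps_inv (qEuler2_series N) k.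

Lemma qfact_neq0 n :
  (forall m, (0 < m)%N -> ~~ m.-unity_root q) -> qfact n != 0.
Proof.
move=> qroot; have qn1 m : (0 < m)%N -> 1 - q ^+ m != 0.
  by move=> /qroot; rewrite unity_rootE subr_eq0 eq_sym.
rewrite /qfact big_nat; elim/big_rec: _ => [|i x /andP[i0 _] x0].
  exact: oner_neq0.
by rewrite mulf_neq0 // mulf_neq0 ?invr_eq0 ?qn1 // -[q]expr1 qn1.
Qed.

Lemma qEuler2_egf N :
  (forall m, (0 < m)%N -> ~~ m.-unity_root q) ->
  fps_mul (fun k => qEuler2 N k / k`!%:R) (qEuler2_series N) =1 fps_one K.
Proof.
move=> qroot k; rewrite -(@fps_mulVf _ (qEuler2_series N)).
  apply: eq_bigr => i _; congr (_ * _).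
  by rewrite /qEuler2 mulrAC divff ?mul1r // pnatr_eq0 -lt0n fact_gt0.
by rewrite /qEuler2_series /= /qEuler2_ratio mulf_neq0 ?invr_eq0 ?qfact_neq0.
Qed.

End QEuler.

(* Main.v *)
Require Import Defs.
From HB Require Import structures.
From mathcomp Require Import all_boot all_order all_algebra.
From mathcomp Require Import reals complex.
Set Implicit Arguments.
Unset Strict Implicit.
Unset Printing Implicit Defensive.
Import Order.TTheory GRing.Theory Num.Theory.
Local Open Scope ring_scope.

(** The formula is Wronski's determinant for the reciprocal of a power series,
    read in the variable x^2.

    Let f have constant term 1 and let g * f = 1. The first n + 1 coefficients
    of this identity say that the lower triangular Toeplitz matrix T with
    entries f (i - j) maps the column of coefficients of g to the first basis
    vector. As T is unitriangular, its inverse is its adjugate, so g n is the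
    cofactor of T at row 0 and column n. Deleting that row and that column
    leaves the entries f (i + 1 - j), which form the Hessenberg matrix of the
    statement: its superdiagonal of ones is the old diagonal, and the cofactor
    sign is (-1) ^ n. This is [fps_inverse_coef_det].

    The series here is even, so the even coefficients of its reciprocal are
    those of the reciprocal of n |-> [qEuler2_ratio q N n]
    ([fps_mul_even_part]). That q is not a root of unity makes the q-factorials
    nonzero, which gives constant term 1. *)

(** Cramer's rule for the unitriangular Toeplitz system [T *m g = e_0]. *)
Lemma fps_inverse_coef_det (K : fieldType) (f g : fps K) n :
    f 0%N = 1 -> fps_mul g f =1 fps_one K ->
  g n = (-1) ^+ n *
    \det (\matrix_(i < n, j < n) if (j <= i.+1)%N then f (i.+1 - j)%N else 0).
Proof.
move=> f0 gf1.
pose T := \matrix_(i < n.+1, j < n.+1) if (j <= i)%N then f (i - j)%N else 0.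
have detT : \det T = 1.
  rewrite det_trig; last by apply/is_trig_mxP => i j ltij; rewrite mxE leqNgt ltij.
  by apply: big1 => i _; rewrite mxE leqnn subnn.
have Tg : T *m \col_(i < n.+1) g i = delta_mx 0 0.
  apply/matrixP => i j; rewrite !mxE ord1 eqxx andbT.
  rewrite -[RHS](gf1 i) /fps_mul (big_ord_widen n.+1 (fun k => g k * f (i - k)%N)) //.
  rewrite [RHS]big_mkcond; apply: eq_bigr => k _; rewrite !mxE ltnS.
  by case: leqP => _; rewrite ?mul0r // mulrC.
have /(congr1 (mulmx (\adj T))) := Tg.
rewrite mulmxA mul_adj_mx detT mul1mx -colE => /matrixP/(_ ord_max 0).
rewrite !mxE /= /cofactor add0n => ->; congr (_ * \det _).
by apply/matrixP => i j; rewrite !mxE !lift0 lift_max.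
Qed.

Lemma sum_even_terms (K : fieldType) (F : nat -> K) k :
    (forall i, odd i -> (i < k.*2)%N -> F i = 0) ->
  \sum_(i < k.*2.+1) F i = \sum_(i < k.+1) F i.*2.
Proof.
elim: k => [|k IHk] F0; first by rewrite !big_ord1.
rewrite doubleS 2!big_ord_recr /= IHk => [|i oi lti]; last first.
  by rewrite F0 // doubleS !ltnS ltnW // ltnW.
by rewrite F0 ?doubleS //= ?odd_double // addr0 [RHS]big_ord_recr.
Qed.

(** When [h] is even, the odd coefficients of [g] only meet odd, hence zero,
    coefficients of [h] in the even coefficients of the product. *)
Lemma fps_mul_even_part (K : fieldType) (g h : fps K) k :
    (forall i, odd i -> h i = 0) ->
  fps_mul (fun i => g i.*2) (fun i => h i.*2) k = fps_mul g h k.*2.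
Proof.
move=> h0; rewrite /fps_mul.
rewrite (sum_even_terms (F := fun i => g i * h (k.*2 - i)%N)) => [|i oi lti].
  by apply: eq_bigr => i _; rewrite doubleB.
by rewrite h0 ?mulr0 // oddB ?odd_double // ltnW.
Qed.

Theorem theorem8 (R : realType) (q : R[i]) (q_neq1 : q != 1)
    (q_not_root : forall m : nat, (0 < m)%N -> ~~ m.-unity_root q)
    (N n : nat) (n_ge1 : (1 <= n)%N) :
  qEuler2 q N (2 * n) =
    (-1) ^+ n * (2 * n)`!%:R *
    \det (\matrix_(i < n, j < n)
      (if (j <= i)%N
       then qfact q (2 * N + 1) / qfact q (2 * N + 1 + 2 * (i - j + 1))
       else if j == i.+1 :> nat then 1 else 0)).
Proof.
have ratio0 : qEuler2_ratio q N 0 = 1.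
  by rewrite /qEuler2_ratio muln0 addn0 divff ?qfact_neq0.
have series_odd i : odd i -> qEuler2_series q N i = 0.
  by rewrite /qEuler2_series => ->.
have series_even i : qEuler2_series q N i.*2 = qEuler2_ratio q N i.
  by rewrite /qEuler2_series odd_double doubleK.
have inv_even : fps_mul (fun i => fps_inv (qEuler2_series q N) i.*2)
    (qEuler2_ratio q N) =1 fps_one _.
  move=> k; transitivity (fps_one R[i] k.*2); last by rewrite /fps_one double_eq0.
  rewrite -(@fps_mulVf _ (qEuler2_series q N)); last first.
    by rewrite (series_even 0%N) ratio0 oner_neq0.
  rewrite -fps_mul_even_part //.
  by apply: eq_bigr => i _; rewrite series_even.
rewrite /qEuler2 mul2n (fps_inverse_coef_det n ratio0 inv_even) mulrCA mulrA.
congr (_ * \det _); apply/matrixP => i j; rewrite !mxE leq_eqVlt ltnS.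
(* The diagonal j = i + 1 of ones is the constant term. *)
case: leqP => [leji | ltij]; last first.
  by rewrite orbF; case: eqP => // ->; rewrite subnn ratio0.
by rewrite orbT /qEuler2_ratio subSn // -[(i - j).+1]addn1 (addnAC (2 * N)%N).
Qed.
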